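(* Let $(F,A)_Q$ be a distributive soft quasigroup. Then $\left(F_Q^\rho,A\right)=\left\{\left(F_x^\rho,A\right)_Q\right\}_{x\in Q}$ and $\left(F_Q^\lambda,A\right)=\left\{\left({}_xF^\lambda,A\right)_Q\right\}_{x\in Q}$ are both families of distributive soft quasigroups.
   Context: A quasigroup is a nonempty set $Q$ with a binary operation $\cdot$ such that for all $a,b\in Q$ each of the equations $a\cdot x=b$ and $y\cdot a=b$ has a unique solution in $Q$; juxtaposition denotes the operation. A nonempty subset $H\subseteq Q$ is a subquasigroup ($H\le Q$) if it is closed under the operation and is a quasigroup under it. $Q$ is distributive if $x(yz)=(xy)(xz)$ and $(yz)x=(yx)(zx)$ for all $x,y,z\in Q$. A soft set $(F,A)$ over $Q$ consists of a set $A$ of parameters and a map $F:A\to 2^{Q}\setminus\{\emptyset\}$. It is a soft quasigroup $(F,A)_Q$ over $Q$ if $F(a)\le Q$ for all $a\in A$; it is a distributive soft quasigroup if in addition $Q$ is a distributive quasigroup. For $x\in Q$, the $x$-right coset soft set $(F_x^\rho,A)$ is the soft set $a\mapsto F(a)\cdot x=\{hx:h\in F(a)\}$, and the $x$-left coset soft set $({}_xF^\lambda,A)$ is the soft set $a\mapsto x\cdot F(a)=\{xh:h\in F(a)\}$. The right coset of $(F,A)_Q$ is the family $(F_Q^\rho,A)=\{(F_x^\rho,A)_Q\}_{x\in Q}$ and the left coset is the family $(F_Q^\lambda,A)=\{({}_xF^\lambda,A)_Q\}_{x\in Q}$. *)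

(* Defs.v *)
From mathcomp Require Import all_boot.
From mathcomp Require Import boolp classical_sets.

Set Implicit Arguments.
Unset Strict Implicit.
Unset Printing Implicit Defensive.

Local Open Scope classical_set_scope.

(* Stated relative to a subset [H] of a carrier, so that the same notion
   serves for a quasigroup ([H = setT]) and for its subquasigroups. *)
Definition quasigroup_on (T : Type) (op : T -> T -> T) (H : set T) : Prop :=
  [/\ H !=set0,
      forall a b, H a -> H b -> H (op a b),
      forall a b, H a -> H b -> exists! x, H x /\ op a x = b
    & forall a b, H a -> H b -> exists! y, H y /\ op y a = b].

Record quasigroup := Quasigroup {
  qsort :> Type;
  qop : qsort -> qsort -> qsort;
  qaxiom : quasigroup_on qop setT }.

Definition subquasigroup (Q : quasigroup) (H : set Q) : Prop :=
  quasigroup_on (@qop Q) H.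

Definition distributive_quasigroup (Q : quasigroup) : Prop :=
  (forall x y z : Q, qop x (qop y z) = qop (qop x y) (qop x z)) /\
  (forall x y z : Q, qop (qop y z) x = qop (qop y x) (qop z x)).

Record soft_set (A Q : Type) := SoftSet {
  soft_map :> A -> set Q;
  soft_map_nonempty : forall a, soft_map a !=set0 }.

Definition soft_quasigroup (A : Type) (Q : quasigroup) (F : soft_set A Q) :
    Prop :=
  forall a, subquasigroup (F a).

Definition distributive_soft_quasigroup (A : Type) (Q : quasigroup)
    (F : soft_set A Q) : Prop :=
  soft_quasigroup F /\ distributive_quasigroup Q.

Section Cosets.
Variables (A : Type) (Q : quasigroup) (F : soft_set A Q).

Lemma right_coset_nonempty (x : Q) (a : A) :
  [set qop h x | h in F a] !=set0.
Proof. by have [h Fh] := soft_map_nonempty F a; exists (qop h x), h. Qed.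

Lemma left_coset_nonempty (x : Q) (a : A) :
  [set qop x h | h in F a] !=set0.
Proof. by have [h Fh] := soft_map_nonempty F a; exists (qop x h), h. Qed.

Definition right_coset_soft_set (x : Q) : soft_set A Q :=
  SoftSet (right_coset_nonempty x).

Definition left_coset_soft_set (x : Q) : soft_set A Q :=
  SoftSet (left_coset_nonempty x).

Definition right_coset : Q -> soft_set A Q := fun x => right_coset_soft_set x.

Definition left_coset : Q -> soft_set A Q := fun x => left_coset_soft_set x.

End Cosets.

Definition family_of_distributive_soft_quasigroups (I A : Type)
    (Q : quasigroup) (G : I -> soft_set A Q) : Prop :=
  forall i, distributive_soft_quasigroup (G i).

(* Main.v *)
Require Import Defs.
From mathcomp Require Import all_boot.
From mathcomp Require Import boolp classical_sets.

(** Distributivity says precisely that every translation of [Q] is an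
    endomorphism: left distributivity for [h |-> x h], right distributivity for
    [h |-> h x]. In a quasigroup translations are also injective, and an
    injective endomorphism carries a subquasigroup isomorphically onto its
    image ([quasigroup_on_image]). Hence each coset [F(a) x] and [x F(a)] is
    again a subquasigroup; distributivity of the ambient [Q] is a hypothesis. *)

Local Open Scope classical_set_scope.

(** Divisions in the image are computed by pulling back along [f]. Injectivity
    is what makes their uniqueness transfer: a homomorphic image of a quasigroup
    need not have unique division. *)
Lemma quasigroup_on_image (T : Type) (op : T -> T -> T) (f : T -> T)
    (H : set T) :
  injective f -> {morph f : u v / op u v} -> quasigroup_on op H ->
  quasigroup_on op [set f h | h in H].
Proof.
move=> f_inj fM [[h0 Hh0] Hop Hldiv Hrdiv]; split.
- by exists (f h0), h0.
- move=> _ _ [h Hh <-] [k Hk <-]; exists (op h k); [exact: Hop | exact: fM].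
- move=> _ _ [h Hh <-] [k Hk <-].
  have [x [[Hx hxk] x_uniq]] := Hldiv h k Hh Hk.
  exists (f x); split; first by split; [exists x | rewrite -fM hxk].
  move=> _ [[y Hy <-]]; rewrite -fM => /f_inj hyk.
  by rewrite (x_uniq y (conj Hy hyk)).
- move=> _ _ [h Hh <-] [k Hk <-].
  have [x [[Hx xhk] x_uniq]] := Hrdiv h k Hh Hk.
  exists (f x); split; first by split; [exists x | rewrite -fM xhk].
  move=> _ [[y Hy <-]]; rewrite -fM => /f_inj yhk.
  by rewrite (x_uniq y (conj Hy yhk)).
Qed.

Lemma left_translation_inj (Q : quasigroup) (x : Q) :
  injective (fun h : Q => qop x h).
Proof.
move=> h k xh_xk; have [_ _ ldiv _] := qaxiom Q.
have [z [_ z_uniq]] := ldiv x (qop x k) I I.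
by rewrite -(z_uniq h (conj I xh_xk)) -(z_uniq k (conj I erefl)).
Qed.

Lemma right_translation_inj (Q : quasigroup) (x : Q) :
  injective (fun h : Q => qop h x).
Proof.
move=> h k hx_kx; have [_ _ _ rdiv] := qaxiom Q.
have [z [_ z_uniq]] := rdiv x (qop k x) I I.
by rewrite -(z_uniq h (conj I hx_kx)) -(z_uniq k (conj I erefl)).
Qed.

Theorem lemma3p3 (A : Type) (Q : quasigroup) (F : soft_set A Q)
    (hF : distributive_soft_quasigroup F) :
  family_of_distributive_soft_quasigroups (right_coset F) /\
  family_of_distributive_soft_quasigroups (left_coset F).
Proof.
have [Fsub Qdist] := hF; have [ldist rdist] := Qdist.
split=> x; split=> // a.
- apply: quasigroup_on_image (Fsub a); first exact: right_translation_inj.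
  by move=> u v; exact: rdist.
- apply: quasigroup_on_image (Fsub a); first exact: left_translation_inj.
  by move=> u v; exact: ldist.
Qed.
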